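(* Let $\tau\in\mathbb{C}$ with $\mathrm{Im}(\tau)>0$ and let $q=e^{\pi i\tau}$. For every complex number $z$, \[ \sin_q(3z)=\frac{\Pi_q}{\Pi_{q^3}}(\cos_{q^3}z)^2\sin_{q^3}z-(\sin_{q^3}z)^3. \]
   Context: For $|q|<1$, $(a;q)_\infty=\prod_{i=0}^{\infty}(1-aq^i)$ and $(a,b;q)_\infty=(a;q)_\infty(b;q)_\infty$. With $q=e^{\pi i\tau}$, $\mathrm{Im}(\tau)>0$, complex powers of $q$ are understood as $q^a=e^{\pi i\tau a}$. Gosper's $q$-sine and $q$-cosine are the functions defined by \[ \sin_q(\pi z)=q^{(z-1/2)^2}\frac{(q^{2z},q^{2-2z};q^2)_\infty}{(q;q^2)_\infty^2},\qquad \cos_q(\pi z)=q^{z^2}\frac{(q^{1+2z},q^{1-2z};q^2)_\infty}{(q;q^2)_\infty^2}\qquad(z\in\mathbb{C}), \] and \[ \Pi_q=q^{1/4}\frac{(q^2;q^2)_\infty^2}{(q;q^2)_\infty^2}. \] For a positive integer $m$, $\sin_{q^m}$, $\cos_{q^m}$ and $\Pi_{q^m}$ are the same expressions with $q$ replaced by $q^m=e^{\pi i m\tau}$ (that is, $\tau$ replaced by $m\tau$). *)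

(* Defs.v *)
From Stdlib Require Import Reals Lra.
From Coquelicot Require Import Coquelicot.

Open Scope R_scope.
Open Scope C_scope.

Definition Cexp (z : C) : C := (exp (Re z) * cos (Im z), exp (Re z) * sin (Im z))%R.

Fixpoint qpoch (a q : C) (n : nat) : C :=
  match n with
  | O => 1
  | S k => qpoch a q k * (1 - a * q ^ k)
  end.

(** [(a; q)_oo], meaningful for [|q| < 1]: [lim] is total, and returns the limit
    of the partial products when they converge (see [qpoch_inf_unique]). *)
Definition qpoch_inf (a q : C) : C :=
  lim (T := C_CompleteNormedModule) (filtermap (qpoch a q) eventually).

(** The base [q = e^(PI i tau)] is always given through [tau], as this is what
    determines the complex powers of [q]: [qpow tau a] is [q^a]. Replacing [q]
    by [q^m] amounts to replacing [tau] by [m * tau]. *)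
Definition qpow (tau a : C) : C := Cexp (PI * Ci * tau * a).

(** The defining formulas of Gosper's functions give their values at [PI * z]
    ([sin_q_PI], [cos_q_PI]), whence the division of the argument by [PI]. *)
Definition sin_q (tau w : C) : C :=
  let z := w / PI in
  qpow tau ((z - 1 / 2) ^ 2)
  * (qpoch_inf (qpow tau (2 * z)) (qpow tau 2)
     * qpoch_inf (qpow tau (2 - 2 * z)) (qpow tau 2))
  / qpoch_inf (qpow tau 1) (qpow tau 2) ^ 2.

Definition cos_q (tau w : C) : C :=
  let z := w / PI in
  qpow tau (z ^ 2)
  * (qpoch_inf (qpow tau (1 + 2 * z)) (qpow tau 2)
     * qpoch_inf (qpow tau (1 - 2 * z)) (qpow tau 2))
  / qpoch_inf (qpow tau 1) (qpow tau 2) ^ 2.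

Definition Pi_q (tau : C) : C :=
  qpow tau (1 / 4) * qpoch_inf (qpow tau 2) (qpow tau 2) ^ 2
  / qpoch_inf (qpow tau 1) (qpow tau 2) ^ 2.

Lemma qpoch_inf_unique (a q l : C) :
  filterlim (qpoch a q) eventually (locally (T := C_UniformSpace) l) ->
  qpoch_inf a q = l.
Proof.
intros H.
pose (F := filtermap (qpoch a q) eventually).
assert (FF : ProperFilter F) by (apply filtermap_proper_filter, eventually_filter).
assert (Hc : cauchy (T := C_CompleteNormedModule) F).
{ intros eps; exists l; apply H; now exists eps. }
pose proof (complete_cauchy (T := C_CompleteNormedModule) F FF Hc) as HL.
apply (eq_close (K := C_AbsRing) (V := C_NormedModule)).
intros eps.
pose (e2 := pos_div_2 eps).
assert (H1 : F (ball (M := C_UniformSpace) l e2)) by (apply H; now exists e2).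
destruct (filter_ex _ (filter_and _ _ (HL e2) H1)) as [x [Hx1 Hx2]].
replace (pos eps) with (e2 + e2)%R by (simpl; lra).
exact (ball_triangle (M := C_UniformSpace) _ x _ _ _ Hx1 (ball_sym _ _ _ Hx2)).
Qed.

Lemma PI_mult_div (z : C) : PI * z / PI = z.
Proof.
field; intros H; apply PI_neq0; now injection H.
Qed.

Lemma sin_q_PI (tau z : C) :
  sin_q tau (PI * z) =
  qpow tau ((z - 1 / 2) ^ 2)
  * (qpoch_inf (qpow tau (2 * z)) (qpow tau 2)
     * qpoch_inf (qpow tau (2 - 2 * z)) (qpow tau 2))
  / qpoch_inf (qpow tau 1) (qpow tau 2) ^ 2.
Proof. unfold sin_q; now rewrite PI_mult_div. Qed.

Lemma cos_q_PI (tau z : C) :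
  cos_q tau (PI * z) =
  qpow tau (z ^ 2)
  * (qpoch_inf (qpow tau (1 + 2 * z)) (qpow tau 2)
     * qpoch_inf (qpow tau (1 - 2 * z)) (qpow tau 2))
  / qpoch_inf (qpow tau 1) (qpow tau 2) ^ 2.
Proof. unfold cos_q; now rewrite PI_mult_div. Qed.

(* Main.v *)
Require Import Defs.
From Stdlib Require Import Reals Lra Lia ZArith List Permutation Classical.
From Coquelicot Require Import Coquelicot.

Open Scope R_scope.
Open Scope C_scope.

(** Put [p = q^6] and [w = q^(6 x)], where [z = PI x], and let
    [theta(u) = (u, p/u; p)_oo]. Splitting every product in base [q^2] into three
    products in base [p] ([theta_split3], [qpoch_inf_odd_split3],
    [qpoch_inf_even_split3]) and dividing by the common factor [theta(w)], the
    identity becomes a relation between three products of two theta functions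
    ([theta_cubic]):

    [theta(q^3)^2 theta(q^2 w) theta(q^4 w)
       = theta(q^2)^2 theta(q^3 w)^2 - (q^2 / w) theta(q)^2 theta(w)^2].

    Up to a monomial, each of the three products is of the form
    [theta(a w) theta(p w / a)]. All functions of this form lie in one space of
    dimension two: by the Jacobi triple product ([jacobi_triple_product]) they
    are products of two bilateral series, which rearrange into two products of
    series where [w] and [a] are separated ([theta_mul], [theta_pairs_rank_2]).
    Hence there is a linear relation between the three functions, and the zeros
    [w = 1] of [theta(w)] and [w = q^(-3)] of [theta(q^3 w)] determine its
    coefficients. Separation is used as the vanishing of a three by three
    determinant ([theta_pairs_det]), so that no basis has to be chosen.

    The analysis behind this is elementary. The products [(a; p)_oo] converge,
    and do not vanish when [|a| < 1] ([qpoch_tends], [qpoch_inf_neq_0]). Bilateral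
    series are unordered sums, for which reindexing is immediate; a product of
    two sums is a sum over pairs ([unordered_sum_prod]), and the triple product
    is the limit of a finite identity by dominated convergence ([tannery]). *)

(** * Limits of complex functions along a filter *)

(** Limits are measured with [Cmod], which is multiplicative, and not with the
    sup-norm balls that generate the neighbourhoods of [C_UniformSpace]. *)
Definition tends {T : Type} (F : (T -> Prop) -> Prop) (f : T -> C) (l : C) : Prop :=
  forall eps : R, (0 < eps)%R -> F (fun x => Cmod (f x - l) < eps)%R.

Lemma tends_filterlim {T : Type} (F : (T -> Prop) -> Prop) {FF : Filter F}
  (f : T -> C) (l : C) :
  tends F f l <-> filterlim f F (locally (T := C_UniformSpace) l).
Proof.
rewrite (filterlim_locally_ball_norm (U := C_NormedModule)); split.
- intros H eps; apply (H eps), cond_pos.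
- intros H eps Heps; exact (H (mkposreal eps Heps)).
Qed.

Lemma tends_ext {T : Type} (F : (T -> Prop) -> Prop) {FF : Filter F}
  (f g : T -> C) (l : C) :
  (forall x, f x = g x) -> tends F f l -> tends F g l.
Proof.
intros E H eps Heps; generalize (H eps Heps); apply filter_imp.
now intros x; rewrite E.
Qed.

Lemma tends_const {T : Type} (F : (T -> Prop) -> Prop) {FF : Filter F} (l : C) :
  tends F (fun _ => l) l.
Proof.
intros eps Heps; apply filter_forall; intros _.
replace (l - l) with (RtoC 0) by ring; now rewrite Cmod_0.
Qed.

Lemma tends_comp {S T : Type} (F : (S -> Prop) -> Prop) (G : (T -> Prop) -> Prop)
  (phi : S -> T) (f : T -> C) (l : C) :
  filterlim phi F G -> tends G f l -> tends F (fun x => f (phi x)) l.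
Proof. intros Hphi H eps Heps; exact (Hphi _ (H eps Heps)). Qed.

Lemma tends_unique {T : Type} (F : (T -> Prop) -> Prop) {FF : ProperFilter F}
  (f : T -> C) (l m : C) : tends F f l -> tends F f m -> l = m.
Proof.
intros Hl Hm.
apply (filterlim_locally_unique (V := C_NormedModule) (F := F) f);
  now apply tends_filterlim; try apply FF.
Qed.

Lemma tends_plus {T : Type} (F : (T -> Prop) -> Prop) {FF : Filter F}
  (f g : T -> C) (l m : C) :
  tends F f l -> tends F g m -> tends F (fun x => f x + g x) (l + m).
Proof.
intros Hf Hg eps Heps.
assert (He : (0 < eps / 2)%R) by lra.
generalize (filter_and _ _ (Hf _ He) (Hg _ He)); apply filter_imp.
intros x [Hx Hy].
replace (f x + g x - (l + m)) with ((f x - l) + (g x - m)) by ring.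
pose proof (Cmod_triangle (f x - l) (g x - m)); lra.
Qed.

Lemma tends_mult {T : Type} (F : (T -> Prop) -> Prop) {FF : Filter F}
  (f g : T -> C) (l m : C) :
  tends F f l -> tends F g m -> tends F (fun x => f x * g x) (l * m).
Proof.
intros Hf Hg eps Heps.
pose proof (Cmod_ge_0 l) as Hl; pose proof (Cmod_ge_0 m) as Hm.
set (K := (1 + Cmod l + Cmod m)%R).
assert (HK : (1 <= K)%R) by (unfold K; lra).
set (d := Rmin 1 (eps / K)).
assert (Hd : (0 < d)%R).
{ apply Rmin_glb_lt; [lra|apply Rdiv_lt_0_compat; lra]. }
generalize (filter_and _ _ (Hf _ Hd) (Hg _ Hd)); apply filter_imp.
intros x [Hx Hy].
replace (f x * g x - l * m)
  with ((f x - l) * (g x - m) + (l * (g x - m) + m * (f x - l))) by ring.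
pose proof (Cmod_triangle ((f x - l) * (g x - m)) (l * (g x - m) + m * (f x - l))) as H1.
pose proof (Cmod_triangle (l * (g x - m)) (m * (f x - l))) as H2.
rewrite Cmod_mult in H1; rewrite (Cmod_mult l), (Cmod_mult m) in H2.
pose proof (Cmod_ge_0 (f x - l)) as Hx0; pose proof (Cmod_ge_0 (g x - m)) as Hy0.
assert (d1 : (d <= 1)%R) by apply Rmin_l.
assert (dK : (d * K <= eps)%R).
{ apply Rle_trans with (eps / K * K)%R.
  - apply Rmult_le_compat_r; [lra|apply Rmin_r].
  - right; field; lra. }
unfold K in dK.
assert (A1 : (Cmod (f x - l) * Cmod (g x - m) <= Cmod (f x - l))%R) by nra.
assert (A2 : (Cmod l * Cmod (g x - m) <= Cmod l * d)%R) by (apply Rmult_le_compat_l; lra).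
assert (A3 : (Cmod m * Cmod (f x - l) <= Cmod m * d)%R) by (apply Rmult_le_compat_l; lra).
lra.
Qed.

Lemma tends_inv {T : Type} (F : (T -> Prop) -> Prop) {FF : Filter F}
  (f : T -> C) (l : C) :
  l <> 0 -> tends F f l -> tends F (fun x => / f x) (/ l).
Proof.
intros Hl Hf eps Heps.
assert (L : (0 < Cmod l)%R) by now apply Cmod_gt_0.
set (d := Rmin (Cmod l / 2) (eps * (Cmod l * Cmod l / 2))).
assert (Hd : (0 < d)%R).
{ apply Rmin_glb_lt; [lra|]. apply Rmult_lt_0_compat; [lra|nra]. }
generalize (Hf _ Hd); apply filter_imp; intros x Hx.
assert (d1 : (d <= Cmod l / 2)%R) by apply Rmin_l.
assert (d2 : (d <= eps * (Cmod l * Cmod l / 2))%R) by apply Rmin_r.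
assert (Hfx : (Cmod l / 2 < Cmod (f x))%R).
{ pose proof (Cmod_triangle (f x) (- (f x - l))) as H.
  replace (f x + - (f x - l)) with l in H by ring.
  rewrite Cmod_opp in H; lra. }
assert (f0 : f x <> 0) by (apply Cmod_gt_0; lra).
replace (/ f x - / l) with (- (f x - l) / (f x * l)) by (field; now split).
rewrite Cmod_div by now apply Cmult_neq_0.
rewrite Cmod_opp, Cmod_mult.
assert (0 < Cmod (f x) * Cmod l)%R by nra.
apply Rmult_lt_reg_r with (Cmod (f x) * Cmod l)%R; [easy|].
unfold Rdiv; rewrite Rmult_assoc, Rinv_l, Rmult_1_r by lra.
apply Rlt_le_trans with (1 := Hx), Rle_trans with (1 := d2).
apply Rmult_le_compat_l; nra.
Qed.

Lemma tends_bounded (u : nat -> C) (l : C) :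
  tends eventually u l -> exists M : R, forall n, (Cmod (u n) <= M)%R.
Proof.
intros H; destruct (H 1%R Rlt_0_1) as [N HN].
assert (B : forall k, exists M : R, forall n, (n < k)%nat -> (Cmod (u n) <= M)%R).
{ induction k as [|k [M HM]].
  - exists 0%R; lia.
  - exists (Rmax M (Cmod (u k))); intros n Hn.
    destruct (Nat.eq_dec n k) as [->|Hk]; [apply Rmax_r|].
    apply Rle_trans with M; [apply HM; lia|apply Rmax_l]. }
destruct (B N) as [M HM].
exists (Rmax M (1 + Cmod l)); intros n.
destruct (Nat.lt_ge_cases n N) as [Hn|Hn].
- apply Rle_trans with M; [now apply HM|apply Rmax_l].
- apply Rle_trans with (1 + Cmod l)%R; [|apply Rmax_r].
  pose proof (Cmod_triangle (u n - l) l) as T.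
  replace (u n - l + l) with (u n) in T by ring.
  specialize (HN n Hn); lra.
Qed.

(** * Infinite products *)

Lemma exp_le_exp (x y : R) : (x <= y)%R -> (exp x <= exp y)%R.
Proof. intros [H| ->]; [left; now apply exp_increasing|apply Rle_refl]. Qed.

Lemma qpoch_bounded (a q : C) :
  (Cmod q < 1)%R -> exists M : R, forall n, (Cmod (qpoch a q n) <= M)%R.
Proof.
intros Hq.
pose proof (Cmod_ge_0 a) as Ha; pose proof (Cmod_ge_0 q) as Hq0.
assert (S : forall n, 
  (Cmod (qpoch a q n) <= exp (Cmod a * ((1 - Cmod q ^ n) / (1 - Cmod q))))%R).
{ induction n as [|n IH]; simpl.
  - rewrite Cmod_1; replace (_ * _)%R with 0%R by (field; lra); rewrite exp_0; lra.
  - rewrite Cmod_mult.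
    replace (Cmod a * ((1 - Cmod q * Cmod q ^ n) / (1 - Cmod q)))%R
      with (Cmod a * ((1 - Cmod q ^ n) / (1 - Cmod q)) + Cmod a * Cmod q ^ n)%R
      by (field; lra).
    rewrite exp_plus.
    apply Rmult_le_compat; try apply Cmod_ge_0; [exact IH|].
    apply Rle_trans with (1 + Cmod a * Cmod q ^ n)%R; [|apply exp_ineq1_le].
    pose proof (Cmod_triangle 1 (- (a * q ^ n))) as H.
    rewrite Cmod_opp, Cmod_mult, Cmod_pow, Cmod_1 in H; exact H. }
exists (exp (Cmod a * (1 / (1 - Cmod q)))); intros n.
apply Rle_trans with (1 := S n).
assert (P : (0 <= Cmod q ^ n)%R) by now apply pow_le.
apply exp_le_exp, Rmult_le_compat_l; [easy|].
apply Rmult_le_compat_r; [left; apply Rinv_0_lt_compat; lra|lra].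
Qed.

(** The successive differences of the partial products are, up to a bounded
    factor, the terms of a geometric series. *)
Lemma qpoch_tends (a q : C) :
  (Cmod q < 1)%R -> tends eventually (qpoch a q) (qpoch_inf a q).
Proof.
intros Hq.
destruct (qpoch_bounded a q Hq) as [M HM].
pose (d := fun n => qpoch a q n * (- (a * q ^ n))).
assert (Hd : ex_series (V := C_CompleteNormedModule) d).
{ apply (ex_series_le (V := C_CompleteNormedModule)) with 
    (b := fun n => (M * Cmod a * Cmod q ^ n)%R).
  - intros n; change (Cmod (d n) <= M * Cmod a * Cmod q ^ n)%R; unfold d.
    rewrite Cmod_mult, Cmod_opp, Cmod_mult, Cmod_pow, Rmult_assoc.
    apply Rmult_le_compat_r; [|apply HM].
    apply Rmult_le_pos; [apply Cmod_ge_0|apply pow_le, Cmod_ge_0].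
  - apply (ex_series_scal (K := R_AbsRing) (V := R_NormedModule)), ex_series_geom.
    rewrite Rabs_pos_eq; [easy|apply Cmod_ge_0]. }
destruct Hd as [s Hs].
assert (E : forall n, sum_n d n = qpoch a q (S n) - 1).
{ induction n as [|n IH].
  - rewrite sum_O; unfold d; simpl; ring.
  - rewrite sum_Sn, IH; change (qpoch a q (S n) - 1 + d (S n) = qpoch a q (S (S n)) - 1).
    unfold d; simpl; ring. }
assert (L : tends eventually (qpoch a q) (s + 1)).
{ intros eps Heps.
  apply (tends_filterlim (T := nat) eventually (sum_n d) s) in Hs.
  destruct (Hs eps Heps) as [N HN].
  exists (S N); intros [|n] Hn; [lia|].
  specialize (HN n ltac:(lia)); rewrite E in HN.
  now replace (qpoch a q (S n) - (s + 1)) with (qpoch a q (S n) - 1 - s) by ring. }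
rewrite (qpoch_inf_unique a q (s + 1)); [easy|].
exact (proj1 (tends_filterlim eventually _ _) L).
Qed.

Lemma filterlim_nat_ge (phi : nat -> nat) :
  (forall n, (n <= phi n)%nat) -> filterlim phi eventually eventually.
Proof.
intros H Q [N HN]; exists N; intros n Hn; apply HN; specialize (H n); lia.
Qed.

Lemma qpoch_inf_eq_lim (a q l : C) (phi : nat -> nat) :
  (Cmod q < 1)%R -> (forall n, (n <= phi n)%nat) ->
  tends eventually (fun n => qpoch a q (phi n)) l -> qpoch_inf a q = l.
Proof.
intros Hq Hphi Hl.
apply (tends_unique eventually (fun n => qpoch a q (phi n))); [|easy].
apply tends_comp with (2 := qpoch_tends a q Hq), filterlim_nat_ge, Hphi.
Qed.

Lemma qpoch_add (a q : C) (n m : nat) :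
  qpoch a q (n + m) = qpoch a q n * qpoch (a * q ^ n) q m.
Proof.
induction m as [|m IH].
- rewrite Nat.add_0_r; simpl; ring.
- rewrite Nat.add_succ_r; simpl; rewrite IH, Cpow_add_r; ring.
Qed.

Lemma qpoch_inf_add (a q : C) (n : nat) :
  (Cmod q < 1)%R -> qpoch_inf a q = qpoch a q n * qpoch_inf (a * q ^ n) q.
Proof.
intros Hq.
apply qpoch_inf_eq_lim with (phi := fun m => (n + m)%nat); [easy|intros; lia|].
apply (tends_ext eventually) with (fun m => qpoch a q n * qpoch (a * q ^ n) q m).
- intros m; now rewrite qpoch_add.
- apply (tends_mult eventually); [apply (tends_const eventually)|now apply qpoch_tends].
Qed.

Lemma qpoch_inf_split3 (a q : C) :
  (Cmod q < 1)%R ->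
  qpoch_inf a q =
  qpoch_inf a (q ^ 3) * qpoch_inf (a * q) (q ^ 3) * qpoch_inf (a * q ^ 2) (q ^ 3).
Proof.
intros Hq.
assert (Hq3 : (Cmod (q ^ 3) < 1)%R).
{ rewrite Cmod_pow; apply pow_lt_1_compat; [split; [apply Cmod_ge_0|easy]|lia]. }
apply qpoch_inf_eq_lim with (phi := fun n => (3 * n)%nat); [easy|intros; lia|].
apply (tends_ext eventually) with (fun n =>
  qpoch a (q ^ 3) n * qpoch (a * q) (q ^ 3) n * qpoch (a * q ^ 2) (q ^ 3) n).
- intros n; induction n as [|n IH]; [simpl; ring|].
  replace (3 * S n)%nat with (3 * n + 3)%nat by lia.
  rewrite qpoch_add, <- IH, (Cpow_mult_r q 3 n); cbn [qpoch].
  generalize ((q ^ 3) ^ n); intros Q; simpl; ring.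
- now repeat apply (tends_mult eventually); apply qpoch_tends.
Qed.

(** By the Weierstrass product inequality, the partial products of a tail whose
    terms [|a q^k|] have sum at most [1/2] are at least [1/2] in modulus. *)
Lemma qpoch_inf_neq_0 (a q : C) :
  (Cmod a < 1)%R -> (Cmod q < 1)%R -> qpoch_inf a q <> 0.
Proof.
intros Ha Hq.
pose proof (Cmod_ge_0 a) as Ha0; pose proof (Cmod_ge_0 q) as Hq0.
assert (factor : forall b n, (1 - Cmod b * Cmod q ^ n <= Cmod (1 - b * q ^ n))%R).
{ intros b n; pose proof (Cmod_triangle (1 - b * q ^ n) (b * q ^ n)) as H.
  replace (1 - b * q ^ n + b * q ^ n) with (RtoC 1) in H by ring.
  rewrite Cmod_mult, Cmod_pow, Cmod_1 in H; lra. }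
assert (pow1 : forall n, (0 <= Cmod q ^ n <= 1)%R).
{ intros n; split; [now apply pow_le|].
  rewrite <- (pow1 n); apply pow_incr; lra. }
assert (partial : forall n, qpoch a q n <> 0).
{ induction n as [|n IH]; simpl; [apply C1_nz|].
  apply Cmult_neq_0; [easy|apply Cmod_gt_0].
  specialize (factor a n); specialize (pow1 n); nra. }
assert (tail : forall b, (Cmod b <= (1 - Cmod q) / 2)%R ->
  forall n, (/ 2 <= Cmod (qpoch b q n))%R).
{ intros b Hb; pose proof (Cmod_ge_0 b) as Hb0.
  assert (S : forall n,
    (1 - Cmod b * ((1 - Cmod q ^ n) / (1 - Cmod q)) <= Cmod (qpoch b q n))%R).
  { induction n as [|n IH]; simpl.
    - rewrite Cmod_1; right; field; lra.
    - rewrite Cmod_mult.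
      replace (1 - Cmod q * Cmod q ^ n)%R
        with (1 - Cmod q ^ n + (1 - Cmod q) * Cmod q ^ n)%R by ring.
      unfold Rdiv; rewrite Rmult_plus_distr_r.
      replace ((1 - Cmod q) * Cmod q ^ n * / (1 - Cmod q))%R with (Cmod q ^ n)%R by (field; lra).
      specialize (factor b n); specialize (pow1 n).
      assert (0 <= (1 - Cmod q ^ n) * / (1 - Cmod q))%R.
      { apply Rmult_le_pos; [lra|left; apply Rinv_0_lt_compat; lra]. }
      assert (0 <= 1 - Cmod b * Cmod q ^ n)%R by nra.
      apply Rle_trans with
        ((1 - Cmod b * ((1 - Cmod q ^ n) * / (1 - Cmod q))) * (1 - Cmod b * Cmod q ^ n))%R.
      + assert (0 <= Cmod b * ((1 - Cmod q ^ n) * / (1 - Cmod q))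
          * (Cmod b * Cmod q ^ n))%R; [|lra].
        apply Rmult_le_pos; apply Rmult_le_pos; easy.
      + apply Rle_trans with (Cmod (qpoch b q n) * (1 - Cmod b * Cmod q ^ n))%R.
        * now apply Rmult_le_compat_r.
        * apply Rmult_le_compat_l; [apply Cmod_ge_0|easy]. }
  intros n; apply Rle_trans with (2 := S n).
  apply Rle_trans with (1 - (1 - Cmod q) / 2 * (1 / (1 - Cmod q)))%R; [right; field; lra|].
  apply Rplus_le_compat_l, Ropp_le_contravar.
  specialize (pow1 n).
  apply Rmult_le_compat; try easy.
  - apply Rmult_le_pos; [lra|left; apply Rinv_0_lt_compat; lra].
  - apply Rmult_le_compat_r; [left; apply Rinv_0_lt_compat; lra|lra]. }
destruct (pow_lt_1_zero (Cmod q)) with (y := ((1 - Cmod q) / 2)%R) as [N HN].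
{ now rewrite Rabs_pos_eq. }
{ lra. }
rewrite (qpoch_inf_add a q N Hq).
apply Cmult_neq_0; [apply partial|].
intros Z.
pose proof (qpoch_tends (a * q ^ N) q Hq) as L; rewrite Z in L.
destruct (L (/ 2)%R ltac:(lra)) as [m Hm].
specialize (Hm m (Nat.le_refl m)).
replace (qpoch (a * q ^ N) q m - 0) with (qpoch (a * q ^ N) q m) in Hm by ring.
apply Rlt_not_le in Hm; apply Hm, tail.
rewrite Cmod_mult, Cmod_pow.
specialize (HN N (Nat.le_refl N)); rewrite Rabs_pos_eq in HN by now apply pow_le.
specialize (pow1 N); nra.
Qed.

(** * Unordered sums *)

Definition sumC {I : Type} (f : I -> C) (L : list I) : C :=
  fold_right (fun i s => f i + s) 0 L.

Definition sumR {I : Type} (b : I -> R) (L : list I) : R :=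
  fold_right (fun i s => b i + s)%R 0%R L.

(** The filter of large finite subsets of [I], a subset being represented by any
    of its duplicate-free enumerations. *)
Definition finsets {I : Type} (Q : list I -> Prop) : Prop :=
  exists L0, forall L, NoDup L -> incl L0 L -> Q L.

Lemma NoDup_support {I : Type} (L : list I) : exists M, NoDup M /\ incl L M /\ incl M L.
Proof.
induction L as [|a L [M [HM [LM ML]]]].
- exists nil; repeat split; [constructor|easy|easy].
- destruct (classic (In a M)) as [Ha|Ha].
  + exists M; split; [easy|split].
    * now apply incl_cons.
    * now apply incl_tl.
  + exists (a :: M); split; [now constructor|split].
    * apply incl_cons; [now left|now apply incl_tl].
    * apply incl_cons; [now left|now apply incl_tl].
Qed.

Global Instance finsets_filter {I : Type} : ProperFilter (@finsets I).
Proof.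
split.
- intros Q [L0 H].
  destruct (NoDup_support L0) as [M [HM [LM _]]]; exists M; now apply H.
- split.
  + now exists nil.
  + intros P Q [L0 HP] [L1 HQ]; exists (L0 ++ L1); intros L HL H; split.
    * apply HP; [easy|]; intros i Hi; apply H, in_or_app; now left.
    * apply HQ; [easy|]; intros i Hi; apply H, in_or_app; now right.
  + intros P Q H [L0 HP]; exists L0; intros L HL Hi; now apply H, HP.
Qed.

Definition unordered_sum {I : Type} (f : I -> C) (s : C) : Prop :=
  tends finsets (sumC f) s.

Definition abs_summable {I : Type} (f : I -> C) : Prop :=
  exists B : R, forall L, NoDup L -> (sumR (fun i => Cmod (f i)) L <= B)%R.

Lemma sumC_app {I : Type} (f : I -> C) (L M : list I) :
  sumC f (L ++ M) = sumC f L + sumC f M.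
Proof. induction L as [|a L IH]; simpl; [|rewrite IH]; ring. Qed.

Lemma sumR_app {I : Type} (b : I -> R) (L M : list I) :
  sumR b (L ++ M) = (sumR b L + sumR b M)%R.
Proof. induction L as [|a L IH]; simpl; [|rewrite IH]; ring. Qed.

Lemma sumC_perm {I : Type} (f : I -> C) (L M : list I) :
  Permutation L M -> sumC f L = sumC f M.
Proof.
induction 1 as [|a L M _ IH|a b L|L M N _ IH _ IH']; simpl;
  [easy|now rewrite IH|ring|now rewrite IH].
Qed.

Lemma sumR_perm {I : Type} (b : I -> R) (L M : list I) :
  Permutation L M -> sumR b L = sumR b M.
Proof.
induction 1 as [|a L M _ IH|a c L|L M N _ IH _ IH']; simpl;
  [easy|now rewrite IH|ring|now rewrite IH].
Qed.

Lemma sumC_plus {I : Type} (f g : I -> C) (L : list I) :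
  sumC (fun i => f i + g i) L = sumC f L + sumC g L.
Proof. induction L as [|a L IH]; simpl; [|rewrite IH]; ring. Qed.

Lemma sumC_scal {I : Type} (c : C) (f : I -> C) (L : list I) :
  sumC (fun i => c * f i) L = c * sumC f L.
Proof. induction L as [|a L IH]; simpl; [|rewrite IH]; ring. Qed.

Lemma sumR_scal {I : Type} (c : R) (b : I -> R) (L : list I) :
  sumR (fun i => c * b i)%R L = (c * sumR b L)%R.
Proof. induction L as [|a L IH]; simpl; [|rewrite IH]; ring. Qed.

Lemma sumC_ext {I : Type} (f g : I -> C) (L : list I) :
  (forall i, f i = g i) -> sumC f L = sumC g L.
Proof. intros E; induction L as [|a L IH]; simpl; [|rewrite E, IH]; easy. Qed.

Lemma sumC_map {I J : Type} (phi : J -> I) (f : I -> C) (L : list J) :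
  sumC f (map phi L) = sumC (fun j => f (phi j)) L.
Proof. induction L as [|a L IH]; simpl; [|rewrite IH]; easy. Qed.

Lemma sumR_map {I J : Type} (phi : J -> I) (b : I -> R) (L : list J) :
  sumR b (map phi L) = sumR (fun j => b (phi j)) L.
Proof. induction L as [|a L IH]; simpl; [|rewrite IH]; easy. Qed.

Lemma sumR_ge_0 {I : Type} (b : I -> R) (L : list I) :
  (forall i, 0 <= b i)%R -> (0 <= sumR b L)%R.
Proof. intros H; induction L as [|a L IH]; simpl; [lra|specialize (H a); lra]. Qed.

Lemma sumR_le {I : Type} (b c : I -> R) (L : list I) :
  (forall i, b i <= c i)%R -> (sumR b L <= sumR c L)%R.
Proof. intros H; induction L as [|a L IH]; simpl; [lra|specialize (H a); lra]. Qed.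

Lemma sumC_Cmod {I : Type} (f : I -> C) (L : list I) :
  (Cmod (sumC f L) <= sumR (fun i => Cmod (f i)) L)%R.
Proof.
induction L as [|a L IH]; simpl; [rewrite Cmod_0; lra|].
pose proof (Cmod_triangle (f a) (sumC f L)); lra.
Qed.

Lemma NoDup_incl_split {I : Type} (L M : list I) :
  NoDup L -> incl L M -> exists R, Permutation M (L ++ R).
Proof.
intros HL; revert M; induction HL as [|a L Ha HL IH]; intros M H.
- now exists M.
- destruct (in_split a M (H a (or_introl eq_refl))) as [M1 [M2 ->]].
  destruct (IH (M1 ++ M2)) as [R HR].
  + intros i Hi; specialize (H i (or_intror Hi)).
    apply in_app_or in H; destruct H as [H|[H|H]].
    * apply in_or_app; now left.
    * now subst i.
    * apply in_or_app; now right.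
  + exists R; simpl; rewrite <- HR; symmetry; apply Permutation_middle.
Qed.

Lemma sumR_incl {I : Type} (b : I -> R) (L M : list I) :
  (forall i, 0 <= b i)%R -> NoDup L -> incl L M -> (sumR b L <= sumR b M)%R.
Proof.
intros Hb HL H; destruct (NoDup_incl_split L M HL H) as [R HR].
rewrite (sumR_perm b _ _ HR), sumR_app.
pose proof (sumR_ge_0 b R Hb); lra.
Qed.

(** The list [L0] nearly attains the supremum of the finite sums, so that
    enlarging any list beyond it changes little. *)
Lemma summable_cauchy {I : Type} (b : I -> R) (B : R) :
  (forall i, 0 <= b i)%R -> (forall L, NoDup L -> (sumR b L <= B)%R) ->
  forall eps : R, (0 < eps)%R -> exists L0, forall L M,
  NoDup L -> NoDup M -> incl L0 L -> incl L M -> (sumR b M - sumR b L < eps)%R.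
Proof.
intros Hb HB eps Heps.
pose (E := fun x => exists L, NoDup L /\ x = sumR b L).
destruct (completeness E) as [s [Hs1 Hs2]].
- exists B; intros x [L [HL ->]]; now apply HB.
- exists (sumR b nil), nil; split; [constructor|easy].
- destruct (classic (exists L, NoDup L /\ (s - eps < sumR b L)%R)) as [[L0 [HL0 H0]]|H].
  + exists L0; intros L M HL HM L0L LM.
    pose proof (sumR_incl b L0 L Hb HL0 L0L).
    assert (sumR b M <= s)%R by (apply Hs1; now exists M).
    lra.
  + assert (s <= s - eps)%R; [|lra].
    apply Hs2; intros x [L [HL ->]].
    apply Rnot_lt_le; intros Hlt; apply H; now exists L.
Qed.

Lemma sumC_cauchy {I : Type} (f : I -> C) (b : I -> R) (L M : list I) (eps : R) :
  (forall i, Cmod (f i) <= b i)%R -> NoDup L -> incl L M ->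
  (sumR b M - sumR b L < eps)%R -> (Cmod (sumC f M - sumC f L) < eps)%R.
Proof.
intros Hf HL LM.
destruct (NoDup_incl_split L M HL LM) as [R HR].
rewrite (sumR_perm b _ _ HR), (sumC_perm f _ _ HR), sumR_app, sumC_app.
replace (sumC f L + sumC f R - sumC f L) with (sumC f R) by ring.
pose proof (sumC_Cmod f R); pose proof (sumR_le _ _ R Hf); lra.
Qed.

Lemma unordered_sum_unique {I : Type} (f : I -> C) (s t : C) :
  unordered_sum f s -> unordered_sum f t -> s = t.
Proof. apply (tends_unique finsets). Qed.

Lemma unordered_sum_ext {I : Type} (f g : I -> C) (s : C) :
  (forall i, f i = g i) -> unordered_sum f s -> unordered_sum g s.
Proof. intros E; apply (tends_ext finsets); intros L; now apply sumC_ext. Qed.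

Lemma unordered_sum_plus {I : Type} (f g : I -> C) (s t : C) :
  unordered_sum f s -> unordered_sum g t -> unordered_sum (fun i => f i + g i) (s + t).
Proof.
intros Hf Hg; apply (tends_ext finsets) with (fun L => sumC f L + sumC g L).
- intros L; now rewrite sumC_plus.
- apply (tends_plus finsets); [easy|easy].
Qed.

Lemma unordered_sum_scal {I : Type} (c : C) (f : I -> C) (s : C) :
  unordered_sum f s -> unordered_sum (fun i => c * f i) (c * s).
Proof.
intros Hf; apply (tends_ext finsets) with (fun L => c * sumC f L).
- intros L; now rewrite sumC_scal.
- apply (tends_mult finsets); [apply (tends_const finsets)|easy].
Qed.

Lemma unordered_sum_bij {I J : Type} (phi : J -> I) (psi : I -> J) (f : I -> C) (s : C) :
  (forall j, psi (phi j) = j) -> (forall i, phi (psi i) = i) ->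
  unordered_sum f s -> unordered_sum (fun j => f (phi j)) s.
Proof.
intros K1 K2 H eps Heps; destruct (H eps Heps) as [L0 HL0].
exists (map psi L0); intros L HL HI; rewrite <- sumC_map; apply HL0.
- apply FinFun.Injective_map_NoDup; [|easy].
  intros x y E; now rewrite <- (K1 x), E, K1.
- intros i Hi; rewrite <- (K2 i); apply in_map, HI, in_map, Hi.
Qed.

(** Dominated convergence: outside one finite set, fixed by the majorant [b], all
    the series [f N] contribute little, and on that set there are finitely many
    limits to take. The existence of the sum of [g] is part of the conclusion, so
    no completeness argument is needed to sum a series. *)
Lemma tannery {I : Type} (f : nat -> I -> C) (s : nat -> C) (g : I -> C) (t : C)
  (b : I -> R) (B : R) :
  (forall L, NoDup L -> (sumR b L <= B)%R) ->
  (forall N i, Cmod (f N i) <= b i)%R ->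
  (forall N, unordered_sum (f N) (s N)) ->
  (forall i, tends eventually (fun N => f N i) (g i)) ->
  tends eventually s t -> unordered_sum g t.
Proof.
intros HB Hf Hs Hg Ht eps Heps.
assert (Hb : forall i, (0 <= b i)%R).
{ intros i; apply Rle_trans with (2 := Hf O i), Cmod_ge_0. }
destruct (summable_cauchy b B Hb HB (eps / 4) ltac:(lra)) as [L0 HL0].
exists L0; intros L HL L0L.
assert (Hsum : tends eventually (fun N => sumC (f N) L) (sumC g L)).
{ clear HL L0L; induction L as [|a L IH]; simpl.
  - apply (tends_const eventually).
  - apply (tends_plus eventually); [apply Hg|exact IH]. }
destruct (filter_ex (F := eventually) _ (filter_and (F := eventually) _ _
  (Hsum (eps / 4)%R ltac:(lra)) (Ht (eps / 4)%R ltac:(lra)))) as [N [H1 H2]].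
destruct (filter_ex (F := @finsets I) _ (filter_and (F := @finsets I) _ _
  (Hs N (eps / 4)%R ltac:(lra))
  (ex_intro _ L (fun M HM LM => conj HM LM) : finsets (fun M => NoDup M /\ incl L M))))
  as [M [H3 [HM LM]]].
pose proof (sumC_cauchy (f N) b L M (eps / 4) (Hf N) HL LM (HL0 L M HL HM L0L LM)) as H4.
replace (sumC g L - t)
  with (- (sumC (f N) L - sumC g L) + (- (sumC (f N) M - sumC (f N) L)
        + ((sumC (f N) M - s N) + (s N - t)))) by ring.
eapply Rle_lt_trans; [apply Cmod_triangle|].
eapply Rle_lt_trans; [apply Rplus_le_compat_l, Cmod_triangle|].
eapply Rle_lt_trans; [apply Rplus_le_compat_l, Rplus_le_compat_l, Cmod_triangle|].
rewrite !(Cmod_opp (_ - _)); lra.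
Qed.

Lemma sumC_prod {I J : Type} (f : I -> C) (g : J -> C) (L : list I) (M : list J) :
  sumC (fun p => f (fst p) * g (snd p)) (list_prod L M) = sumC f L * sumC g M.
Proof.
induction L as [|a L IH]; simpl; [ring|].
rewrite sumC_app, sumC_map, IH; simpl; rewrite sumC_scal; ring.
Qed.

Lemma sumR_prod {I J : Type} (f : I -> R) (g : J -> R) (L : list I) (M : list J) :
  sumR (fun p => f (fst p) * g (snd p))%R (list_prod L M) = (sumR f L * sumR g M)%R.
Proof.
induction L as [|a L IH]; simpl; [ring|].
rewrite sumR_app, sumR_map, IH; simpl; rewrite sumR_scal; ring.
Qed.

Lemma NoDup_list_prod {I J : Type} (L : list I) (M : list J) :
  NoDup L -> NoDup M -> NoDup (list_prod L M).
Proof.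
intros HL HM; induction HL as [|a L Ha HL IH]; simpl; [constructor|].
apply NoDup_app; [|easy|].
- apply FinFun.Injective_map_NoDup; [|easy]; intros x y E; now injection E.
- intros [i j] Hi Hj; apply in_map_iff in Hi; destruct Hi as [y [E _]].
  injection E as -> _; apply in_prod_iff in Hj; now apply Ha.
Qed.

(** A finite set of pairs lies in a rectangle, over which the sum is a product;
    absolute summability makes what the rectangle adds negligible. *)
Lemma unordered_sum_prod {I J : Type} (f : I -> C) (g : J -> C) (s t : C) :
  abs_summable f -> abs_summable g -> unordered_sum f s -> unordered_sum g t ->
  unordered_sum (fun p => f (fst p) * g (snd p)) (s * t).
Proof.
intros [A HA] [B HB] Hf Hg eps Heps.
pose (b := fun p => (Cmod (f (fst p)) * Cmod (g (snd p)))%R).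
assert (b0 : forall p, (0 <= b p)%R) by (intros p; apply Rmult_le_pos; apply Cmod_ge_0).
assert (rect : forall L : list (I * J), exists M1 M2,
  NoDup M1 /\ NoDup M2 /\ incl L (list_prod M1 M2)).
{ intros L.
  destruct (NoDup_support (map fst L)) as [M1 [H1 [I1 _]]].
  destruct (NoDup_support (map snd L)) as [M2 [H2 [I2 _]]].
  exists M1, M2; split; [easy|split; [easy|]].
  intros [i j] H; apply in_prod_iff; split.
  - apply I1, (in_map fst _ _ H).
  - apply I2, (in_map snd _ _ H). }
assert (HAB : forall L, NoDup L -> (sumR b L <= A * B)%R).
{ intros L HL; destruct (rect L) as [M1 [M2 [H1 [H2 H]]]].
  apply Rle_trans with (1 := sumR_incl b _ _ b0 HL H).
  unfold b; rewrite (sumR_prod (fun i => Cmod (f i)) (fun j => Cmod (g j))).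
  apply Rmult_le_compat; try (apply sumR_ge_0; intros; apply Cmod_ge_0).
  - now apply HA.
  - now apply HB. }
destruct (summable_cauchy b (A * B) b0 HAB (eps / 2) ltac:(lra)) as [L0 HL0].
exists L0; intros L HL L0L.
destruct (rect L) as [M1 [M2 [_ [_ H]]]].
assert (T : tends (filter_prod (@finsets I) (@finsets J))
  (fun p => sumC f (fst p) * sumC g (snd p)) (s * t)).
{ apply (tends_mult (filter_prod finsets finsets)).
  - apply tends_comp with (2 := Hf), filterlim_fst.
  - apply tends_comp with (2 := Hg), filterlim_snd. }
assert (U : filter_prod (@finsets I) (@finsets J)
  (fun p => (NoDup (fst p) /\ incl M1 (fst p)) /\ NoDup (snd p) /\ incl M2 (snd p))).
{ exists (fun N => NoDup N /\ incl M1 N) (fun N => NoDup N /\ incl M2 N).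
  - now exists M1.
  - now exists M2.
  - easy. }
destruct (filter_ex (F := filter_prod (@finsets I) (@finsets J)) _
  (filter_and (F := filter_prod (@finsets I) (@finsets J)) _ _ (T (eps / 2)%R ltac:(lra)) U)) as [[N1 N2] [H1 [[D1 I1] [D2 I2]]]].
simpl in *.
assert (LN : incl L (list_prod N1 N2)).
{ intros [i j] Hi; apply H, in_prod_iff in Hi; apply in_prod_iff; split.
  - now apply I1.
  - now apply I2. }
pose proof (NoDup_list_prod N1 N2 D1 D2) as D.
assert (H2 : (Cmod (sumC (fun p => f (fst p) * g (snd p))%C (list_prod N1 N2)
  - sumC (fun p => f (fst p) * g (snd p))%C L) < eps / 2)%R).
{ apply (sumC_cauchy _ b); try easy.
  - intros p; unfold b; rewrite Cmod_mult; lra.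
  - now apply HL0. }
rewrite sumC_prod in H2.
match type of H2 with (Cmod (?u - ?v) < _)%R =>
  replace (v - s * t) with (- (u - v) + (u - s * t)) by ring end.
eapply Rle_lt_trans; [apply Cmod_triangle|]; rewrite Cmod_opp; lra.
Qed.

Lemma unordered_sum_sum {I J : Type} (f : I -> C) (g : J -> C) (s t : C) :
  unordered_sum f s -> unordered_sum g t ->
  unordered_sum (fun x => match x with inl i => f i | inr j => g j end) (s + t).
Proof.
intros Hf Hg.
pose (lefts := fun L : list (I + J) =>
  flat_map (fun x => match x with inl i => i :: nil | inr _ => nil end) L).
pose (rights := fun L : list (I + J) =>
  flat_map (fun x => match x with inl _ => nil | inr j => j :: nil end) L).
assert (in_l : forall L i, In i (lefts L) <-> In (inl i) L).
{ intros L i; unfold lefts; rewrite in_flat_map; split.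
  - intros [[i'|j] [H1 H2]]; [destruct H2 as [H2|[]]|easy]; now subst.
  - intros H; exists (inl i); split; [easy|now left]. }
assert (in_r : forall L j, In j (rights L) <-> In (inr j) L).
{ intros L i; unfold rights; rewrite in_flat_map; split.
  - intros [[i'|j] [H1 H2]]; [easy|destruct H2 as [H2|[]]]; now subst.
  - intros H; exists (inr i); split; [easy|now left]. }
assert (nd_l : forall L, NoDup L -> NoDup (lefts L)).
{ induction 1 as [|[i|j] L H HL IH]; simpl; try constructor; try easy.
  now rewrite in_l. }
assert (nd_r : forall L, NoDup L -> NoDup (rights L)).
{ induction 1 as [|[i|j] L H HL IH]; simpl; try constructor; try easy.
  now rewrite in_r. }
apply (tends_ext finsets) with (fun L => sumC f (lefts L) + sumC g (rights L)).
- induction x as [|[i|j] L IH]; simpl; [ring| |]; rewrite <- IH; unfold lefts, rights; ring.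
- apply (tends_plus finsets); [ |].
  + apply tends_comp with (2 := Hf).
    intros Q [L0 H0]; exists (map inl L0); intros L HL H; apply H0; [now apply nd_l|].
    intros i Hi; apply in_l, H, in_map, Hi.
  + apply tends_comp with (2 := Hg).
    intros Q [L0 H0]; exists (map inr L0); intros L HL H; apply H0; [now apply nd_r|].
    intros i Hi; apply in_r, H, in_map, Hi.
Qed.

(** * The exponential of [PI i a] *)

Definition ee (a : C) : C := Cexp (PI * Ci * a).

Lemma ee_plus (a b : C) : ee (a + b) = ee a * ee b.
Proof.
unfold ee; rewrite Cmult_plus_distr_l; generalize (PI * Ci * a), (PI * Ci * b).
intros [x y] [u v]; unfold Cexp, Re, Im; simpl.
rewrite exp_plus, cos_plus, sin_plus; apply injective_projections; simpl; ring.
Qed.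

Lemma ee_0 : ee 0 = 1.
Proof.
unfold ee; rewrite Cmult_0_r; unfold Cexp, Re, Im; simpl.
rewrite exp_0, cos_0, sin_0; apply injective_projections; simpl; ring.
Qed.

Lemma ee_1 : ee 1 = -(1).
Proof.
unfold ee; replace (PI * Ci * 1) with ((0, PI) : C).
- unfold Cexp, Re, Im; simpl; rewrite exp_0, cos_PI, sin_PI.
  apply injective_projections; simpl; ring.
- apply injective_projections; simpl; ring.
Qed.

Lemma ee_opp (a : C) : ee a * ee (- a) = 1.
Proof. rewrite <- ee_plus, Cplus_opp_r; apply ee_0. Qed.

Lemma ee_neq_0 (a : C) : ee a <> 0.
Proof. intros H; apply C1_nz; rewrite <- (ee_opp a), H; ring. Qed.

Lemma Im_scal (r : R) (a : C) : Im (r * a) = (r * Im a)%R.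
Proof. destruct a as [x y]; unfold Im; simpl; ring. Qed.

Lemma Cmod_ee (a : C) : Cmod (ee a) = exp (- (PI * Im a)).
Proof.
unfold ee, Cexp.
replace (Re (PI * Ci * a)) with (- (PI * Im a))%R
  by (destruct a as [x y]; unfold Re, Im; simpl; ring).
generalize (- (PI * Im a))%R, (Im (PI * Ci * a)); intros x y.
unfold Cmod; simpl.
replace (_ + _)%R with (exp x * exp x)%R.
- apply sqrt_square; left; apply exp_pos.
- pose proof (sin2_cos2 y) as H; unfold Rsqr in H.
  replace (exp x * exp x)%R with (exp x * exp x * (sin y * sin y + cos y * cos y))%R
    by (rewrite H; ring).
  ring.
Qed.

Lemma Cmod_ee_lt_1 (a : C) : (0 < Im a)%R -> (Cmod (ee a) < 1)%R.
Proof.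
intros Ha; rewrite Cmod_ee, <- exp_0; apply exp_increasing.
pose proof (Rmult_lt_0_compat _ _ PI_RGT_0 Ha); lra.
Qed.

Lemma qpow_ee (tau a : C) : qpow tau a = ee (tau * a).
Proof. unfold qpow, ee; f_equal; ring. Qed.

(** * The Jacobi triple product *)

Definition zC (n : Z) : C := RtoC (IZR n).

Lemma zC_plus (m n : Z) : zC (m + n) = zC m + zC n.
Proof. unfold zC; now rewrite plus_IZR, RtoC_plus. Qed.

Lemma zC_minus (m n : Z) : zC (m - n) = zC m - zC n.
Proof. unfold zC; now rewrite minus_IZR, RtoC_minus. Qed.

Lemma ee_pow (n : nat) (a : C) : ee (zC (Z.of_nat n) * a) = ee a ^ n.
Proof.
induction n as [|n IH].
- replace (zC (Z.of_nat 0) * a) with (RtoC 0) by (unfold zC; simpl; ring); apply ee_0.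
- rewrite Nat2Z.inj_succ; unfold Z.succ; rewrite zC_plus.
  replace ((zC (Z.of_nat n) + zC 1) * a) with (a + zC (Z.of_nat n) * a)
    by (unfold zC at 3; simpl; ring).
  rewrite ee_plus, IH; reflexivity.
Qed.

(** The modified theta function [(x, p/x; p)_oo] with [x = ee xi] and [p = ee sigma]. *)
Definition theta (sigma xi : C) : C :=
  qpoch_inf (ee xi) (ee sigma) * qpoch_inf (ee (sigma - xi)) (ee sigma).

(** This is [(-1)^n p^(n (n - 1) / 2) x^n]: the sign is [ee n], so that each term
    is one exponential, and products of terms are compared on exponents. *)
Definition theta_term (sigma xi : C) (n : Z) : C :=
  ee (zC n + zC n * (zC n - 1) / 2 * sigma + zC n * xi).

(** [1 / (p; p)_k], continued by [0] to negative [k]; with this convention the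
    recurrence [inv_qfact_pred] holds on all of [Z], and truncated sums need no
    boundary terms. *)
Definition inv_qfact (p : C) (k : Z) : C :=
  if (k <? 0)%Z then 0 else / qpoch p p (Z.to_nat k).

Lemma qfact_neq_0 (p : C) (n : nat) : (Cmod p < 1)%R -> qpoch p p n <> 0.
Proof.
intros Hp H; apply (qpoch_inf_neq_0 p p Hp Hp).
rewrite (qpoch_inf_add p p n Hp), H; ring.
Qed.

Lemma inv_qfact_pred (sigma : C) (k : Z) :
  (0 < Im sigma)%R ->
  inv_qfact (ee sigma) (k - 1) = (1 - ee (zC k * sigma)) * inv_qfact (ee sigma) k.
Proof.
intros Hs; unfold inv_qfact.
destruct (Z.ltb_spec k 0) as [H|H].
- replace (k - 1 <? 0)%Z with true by (symmetry; apply Z.ltb_lt; lia); ring.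
- destruct (Z.eq_dec k 0) as [->|H0].
  + replace (zC 0 * sigma) with (RtoC 0) by (unfold zC; ring).
    rewrite ee_0; simpl; ring.
  + replace (k - 1 <? 0)%Z with false by (symmetry; apply Z.ltb_ge; lia).
    destruct (Z_of_nat_complete (k - 1)) as [m Hm]; [lia|].
    replace k with (Z.of_nat (S m)) by lia.
    replace (Z.of_nat (S m) - 1)%Z with (Z.of_nat m) by lia.
    rewrite ee_pow, !Nat2Z.id.
    pose proof (qfact_neq_0 (ee sigma) (S m) (Cmod_ee_lt_1 _ Hs)) as Hn.
    simpl in *; field; split; intros Z; apply Hn; rewrite Z; ring.
Qed.

Lemma inv_qfact_bounded (sigma : C) :
  (0 < Im sigma)%R -> exists M : R, forall k, (Cmod (inv_qfact (ee sigma) k) <= M)%R.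
Proof.
intros Hs; pose proof (Cmod_ee_lt_1 _ Hs) as Hp.
destruct (tends_bounded (fun n => / qpoch (ee sigma) (ee sigma) n)
  (/ qpoch_inf (ee sigma) (ee sigma)))
  as [M HM].
- apply (tends_inv eventually); [now apply qpoch_inf_neq_0|now apply qpoch_tends].
- exists M; intros k; unfold inv_qfact; destruct (k <? 0)%Z; [|apply HM].
  rewrite Cmod_0; apply Rle_trans with (2 := HM O), Cmod_ge_0.
Qed.

Lemma inv_qfact_tends (sigma : C) (k : nat -> Z) :
  (0 < Im sigma)%R -> filterlim (fun n => Z.to_nat (k n)) eventually eventually ->
  eventually (fun n => (0 <= k n)%Z) ->
  tends eventually (fun n => inv_qfact (ee sigma) (k n)) (/ qpoch_inf (ee sigma) (ee sigma)).
Proof.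
intros Hs Hk Hpos eps Heps; pose proof (Cmod_ee_lt_1 _ Hs) as Hp.
assert (L : tends eventually (fun n => / qpoch (ee sigma) (ee sigma) (Z.to_nat (k n)))
  (/ qpoch_inf (ee sigma) (ee sigma))).
{ apply (tends_inv eventually); [now apply qpoch_inf_neq_0|].
  apply tends_comp with (1 := Hk); now apply qpoch_tends. }
generalize (filter_and (F := eventually) _ _ (L eps Heps) Hpos).
apply filter_imp; intros n [H1 H2]; unfold inv_qfact.
now replace (k n <? 0)%Z with false by (symmetry; now apply Z.ltb_ge).
Qed.

Lemma unordered_sum_single {I : Type} (f : I -> C) (i : I) :
  (forall j, j <> i -> f j = 0) -> unordered_sum f (f i).
Proof.
intros H eps Heps; exists (i :: nil); intros L HL HI.
destruct (NoDup_incl_split (i :: nil) L) as [R HR]; [now repeat constructor|easy|].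
rewrite (sumC_perm f _ _ HR); simpl.
assert (ND : NoDup (i :: R)) by now apply (Permutation_NoDup HR).
apply NoDup_cons_iff in ND; destruct ND as [Hi _].
replace (sumC f R) with (RtoC 0).
- replace (f i + 0 - f i) with (RtoC 0) by ring; now rewrite Cmod_0.
- clear HR; induction R as [|j R IH]; [easy|simpl].
  rewrite (H j), <- IH; [ring| |].
  + intros K; apply Hi; now right.
  + intros K; apply Hi; left; easy.
Qed.

Definition finite_theta_coeff (sigma : C) (N : nat) (n : Z) : C :=
  qpoch (ee sigma) (ee sigma) (2 * N)
  * inv_qfact (ee sigma) (Z.of_nat N + n) * inv_qfact (ee sigma) (Z.of_nat N - n).

(** Passing from [N] to [N + 1] multiplies the product by
    [(1 - x p^N) (1 - p^(N + 1) / x)]; on coefficients this is a combination of the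
    sequence with its two shifts, which the q-binomial coefficients satisfy. *)
Lemma finite_triple_product (sigma xi : C) (N : nat) :
  (0 < Im sigma)%R ->
  unordered_sum (fun n => finite_theta_coeff sigma N n * theta_term sigma xi n)
    (qpoch (ee xi) (ee sigma) N * qpoch (ee (sigma - xi)) (ee sigma) N).
Proof.
intros Hs; induction N as [|N IH].
- pose proof (unordered_sum_single
    (fun n => finite_theta_coeff sigma 0 n * theta_term sigma xi n) 0%Z) as H.
  simpl qpoch; replace (1 * 1) with (finite_theta_coeff sigma 0 0 * theta_term sigma xi 0).
  + apply H; intros n Hn; unfold finite_theta_coeff, inv_qfact; simpl Z.of_nat.
    destruct (Z.ltb_spec (0 + n) 0); [ring|].
    destruct (Z.ltb_spec (0 - n) 0); [ring|lia].
  + unfold finite_theta_coeff, theta_term, inv_qfact; simpl.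
    replace (zC 0 + zC 0 * (zC 0 - 1) / 2 * sigma + zC 0 * xi) with (RtoC 0)
      by (unfold zC; field).
    rewrite ee_0; field.
- pose (f := fun n => finite_theta_coeff sigma N n * theta_term sigma xi n).
  pose (s := qpoch (ee xi) (ee sigma) N * qpoch (ee (sigma - xi)) (ee sigma) N).
  pose (X := ee sigma ^ N).
  assert (E1 : unordered_sum (fun n => f (n - 1)%Z) s).
  { apply (unordered_sum_bij (fun n => n - 1)%Z (fun n => n + 1)%Z);
      [intros; lia|intros; lia|exact IH]. }
  assert (E2 : unordered_sum (fun n => f (n + 1)%Z) s).
  { apply (unordered_sum_bij (fun n => n + 1)%Z (fun n => n - 1)%Z);
      [intros; lia|intros; lia|exact IH]. }
  pose proof (unordered_sum_plus _ _ _ _ (unordered_sum_scal (1 + ee sigma * X * X) _ _ IH)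
    (unordered_sum_plus _ _ _ _ (unordered_sum_scal (- (X * ee xi)) _ _ E1)
       (unordered_sum_scal (- (ee (sigma - xi) * X)) _ _ E2))) as H.
  simpl qpoch; fold X.
  assert (Y0 : ee xi * ee (sigma - xi) = ee sigma) by (rewrite <- ee_plus; f_equal; ring).
  match type of H with unordered_sum _ ?t => match goal with |- unordered_sum _ ?u =>
    replace u with t by (unfold s; rewrite <- Y0; ring) end end.
  revert H; apply unordered_sum_ext; intros n; unfold f, finite_theta_coeff.
  pose (y := ee (zC n * sigma)); pose (y' := ee (- (zC n * sigma))).
  assert (Hy : y * y' = 1) by apply ee_opp.
  assert (T1 : ee xi * theta_term sigma xi (n - 1)
    = - (ee sigma * y') * theta_term sigma xi n).
  { replace (- (ee sigma * y')) with (ee 1 * ee sigma * y') by (rewrite ee_1; ring).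
    replace (ee 1) with (ee (-(1))).
    2:{ pose proof (ee_opp 1) as K; rewrite ee_1 in *.
        replace (ee (- (1))) with (- (- (1) * ee (- (1)))) by ring; rewrite K; ring. }
    unfold y', theta_term; rewrite <- !ee_plus, zC_minus; f_equal; unfold zC; field. }
  assert (T2 : ee (sigma - xi) * theta_term sigma xi (n + 1)
    = - (ee sigma * y) * theta_term sigma xi n).
  { replace (- (ee sigma * y)) with (ee 1 * ee sigma * y) by (rewrite ee_1; ring).
    unfold y, theta_term; rewrite <- !ee_plus, zC_plus; f_equal; unfold zC; field. }
  replace (2 * S N)%nat with (S (S (2 * N)))%nat by lia.
  cbn [qpoch].
  assert (P2 : ee sigma ^ (2 * N) = X * X) by (unfold X; rewrite <- Cpow_add_r; f_equal; lia).
  rewrite Cpow_S, P2.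
  (* All the inverse q-factorials are expressed through those of index [N + 1 + n]
     and [N + 1 - n]. *)
  pose proof (inv_qfact_pred sigma (Z.of_nat (S N) + n) Hs) as A1.
  pose proof (inv_qfact_pred sigma (Z.of_nat N + n) Hs) as A2.
  pose proof (inv_qfact_pred sigma (Z.of_nat (S N) - n) Hs) as B1.
  pose proof (inv_qfact_pred sigma (Z.of_nat N - n) Hs) as B2.
  rewrite zC_plus, Cmult_plus_distr_r, ee_plus, ee_pow in A1, A2.
  rewrite zC_minus in B1, B2.
  replace ((zC (Z.of_nat (S N)) - zC n) * sigma)
    with (zC (Z.of_nat (S N)) * sigma + - (zC n * sigma)) in B1 by ring.
  replace ((zC (Z.of_nat N) - zC n) * sigma)
    with (zC (Z.of_nat N) * sigma + - (zC n * sigma)) in B2 by ring.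
  rewrite ee_plus, ee_pow in B1, B2.
  rewrite Cpow_S in A1, B1.
  fold X y in A1, A2; fold X y' in B1, B2.
  replace (Z.of_nat (S N) + n - 1)%Z with (Z.of_nat N + n)%Z in A1 by lia.
  replace (Z.of_nat (S N) - n - 1)%Z with (Z.of_nat N - n)%Z in B1 by lia.
  replace (Z.of_nat N + (n - 1))%Z with (Z.of_nat N + n - 1)%Z by lia.
  replace (Z.of_nat N - (n + 1))%Z with (Z.of_nat N - n - 1)%Z by lia.
  replace (Z.of_nat N - (n - 1))%Z with (Z.of_nat (S N) - n)%Z by lia.
  replace (Z.of_nat N + (n + 1))%Z with (Z.of_nat (S N) + n)%Z by lia.
  rewrite A2, B2, A1, B1.
  set (U := inv_qfact (ee sigma) (Z.of_nat (S N) + n)).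
  set (V := inv_qfact (ee sigma) (Z.of_nat (S N) - n)).
  set (D := qpoch (ee sigma) (ee sigma) (2 * N)).
  set (t := theta_term sigma xi n) in *.
  set (t1 := theta_term sigma xi (n - 1)) in *; set (t2 := theta_term sigma xi (n + 1)) in *.
  set (p := ee sigma) in *.
  transitivity (D * U * V * ((1 + p * X * X) * (1 - p * X * y) * (1 - p * X * y') * t
    + - X * ((1 - X * y) * (1 - p * X * y)) * (ee xi * t1)
    + - X * ((1 - X * y') * (1 - p * X * y')) * (ee (sigma - xi) * t2))); [ring|].
  rewrite T1, T2.
  transitivity (D * U * V * t * ((1 + p * X * X) * (1 - p * X * (y + y') + p * p * X * X * (y * y'))
    + p * X * (y + y' - (X + p * X) * (y * y') * (1 + 1)
       + p * X * X * (y * y') * (y + y')))); [ring|].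
  rewrite Hy; ring.
Qed.

Lemma sumR_geom (r : R) (N : nat) :
  (0 < r < 1)%R -> (sumR (fun k => r ^ k)%R (seq 0 N) <= / (1 - r))%R.
Proof.
intros Hr.
replace (sumR (fun k => r ^ k)%R (seq 0 N)) with ((1 - r ^ N) / (1 - r))%R.
- apply Rle_trans with (1 / (1 - r))%R; [|right; field; lra].
  apply Rmult_le_compat_r; [left; apply Rinv_0_lt_compat; lra|].
  pose proof (pow_le r N); lra.
- induction N as [|N IH]; [simpl; field; lra|].
  rewrite seq_S, sumR_app, <- IH; simpl; field; lra.
Qed.

Lemma sumR_geom_Z (r : R) (L : list Z) :
  (0 < r < 1)%R -> NoDup L -> (sumR (fun n => r ^ Z.abs_nat n)%R L <= 2 / (1 - r))%R.
Proof.
intros Hr HL.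
assert (HN : exists N, forall n, In n L -> (Z.abs_nat n < N)%nat).
{ clear HL; induction L as [|a L [N HN]]; [now exists O|].
  exists (Nat.max N (S (Z.abs_nat a))); intros n [->|Hn]; [lia|].
  specialize (HN n Hn); lia. }
destruct HN as [N HN].
apply Rle_trans with (sumR (fun n => r ^ Z.abs_nat n)%R
  (map Z.of_nat (seq 0 N) ++ map (fun k => - Z.of_nat k)%Z (seq 0 N))).
- apply sumR_incl; [|easy|].
  + intros n; apply pow_le; lra.
  + intros n Hn; specialize (HN n Hn); apply in_or_app.
    destruct (Z.le_ge_cases 0 n) as [H|H]; [left|right]; apply in_map_iff;
      exists (Z.abs_nat n); (split; [lia|apply in_seq; lia]).
- rewrite sumR_app, !sumR_map.
  pose proof (sumR_geom r N Hr) as G.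
  apply Rle_trans with (sumR (fun k => r ^ k) (seq 0 N) + sumR (fun k => r ^ k) (seq 0 N))%R.
  + apply Rplus_le_compat; apply sumR_le; intros k; right; f_equal; lia.
  + unfold Rdiv; lra.
Qed.

(** The modulus is Gaussian in [n]; completing the square in [|n|] compares it to
    [e^(- |n|)]. *)
Lemma theta_term_bound (sigma xi : C) :
  (0 < Im sigma)%R ->
  exists K : R, forall n, (Cmod (theta_term sigma xi n) <= K * exp (-1) ^ Z.abs_nat n)%R.
Proof.
intros Hs.
set (c := (PI * Im sigma)%R); set (d := (PI * Im xi)%R).
assert (Hc : (0 < c)%R) by (apply Rmult_lt_0_compat; [apply PI_RGT_0|easy]).
set (A := (Rabs (c / 2 - d) + 1)%R).
(* [A^2 / (2 c)] is the maximum over [y] of [A y - c y^2 / 2]. *)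
exists (exp (A * A / (2 * c))); intros n.
unfold theta_term; rewrite Cmod_ee.
replace (PI * Im (zC n + zC n * (zC n - 1) / 2 * sigma + zC n * xi))%R
  with (c * (IZR n * (IZR n - 1) / 2) + d * IZR n)%R.
2:{ replace (zC n + zC n * (zC n - 1) / 2 * sigma + zC n * xi)
      with (RtoC (IZR n) + RtoC (IZR n * (IZR n - 1) / 2) * sigma + RtoC (IZR n) * xi).
    - unfold c, d; destruct sigma, xi; unfold Im; simpl; ring.
    - unfold zC; rewrite RtoC_div, RtoC_mult, RtoC_minus by lra; reflexivity. }
replace (exp (-1) ^ Z.abs_nat n)%R with (exp (- Rabs (IZR n))).
- rewrite <- exp_plus; apply exp_le_exp.
  set (x := IZR n); set (y := Rabs x).
  assert (y2 : (x * x = y * y)%R) by (unfold y; rewrite <- Rabs_mult, Rabs_pos_eq; nra).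
  assert (H1 : ((c / 2 - d) * x <= (A - 1) * y)%R).
  { unfold A, y; replace (Rabs (c / 2 - d) + 1 - 1)%R with (Rabs (c / 2 - d)) by ring.
    rewrite <- Rabs_mult; apply Rle_abs. }
  assert (H2 : (A * A / (2 * c) - A * y + c / 2 * (y * y) = (c * y - A) * (c * y - A) / (2 * c))%R)
    by (field; lra).
  assert (H3 : (0 <= (c * y - A) * (c * y - A) / (2 * c))%R).
  { apply Rmult_le_pos; [apply Rle_0_sqr|left; apply Rinv_0_lt_compat; lra]. }
  nra.
- assert (P : forall k : nat, (exp (-1) ^ k = exp (- INR k))%R).
  { induction k as [|k IH]; [simpl; now rewrite Ropp_0, exp_0|].
    rewrite S_INR; simpl pow; rewrite IH, <- exp_plus; f_equal; ring. }
  rewrite P, INR_IZR_INZ, Zabs2Nat.id_abs, abs_IZR; reflexivity.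
Qed.

Lemma exp_m1_lt_1 : (0 < exp (-1) < 1)%R.
Proof.
split; [apply exp_pos|]; rewrite <- exp_0; apply exp_increasing; lra.
Qed.

Lemma theta_term_summable (sigma xi : C) :
  (0 < Im sigma)%R -> abs_summable (theta_term sigma xi).
Proof.
intros Hs; destruct (theta_term_bound sigma xi Hs) as [K HK].
exists (K * (2 / (1 - exp (-1))))%R; intros L HL.
apply Rle_trans with (1 := sumR_le _ _ L HK); rewrite sumR_scal.
apply Rmult_le_compat_l; [|apply sumR_geom_Z; [apply exp_m1_lt_1|easy]].
specialize (HK 0%Z); simpl in HK; rewrite Rmult_1_r in HK.
apply Rle_trans with (2 := HK), Cmod_ge_0.
Qed.

(** The limit of [finite_triple_product]: the coefficients tend to
    [1 / (p; p)_oo] and stay bounded. *)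
Lemma jacobi_triple_product (sigma xi : C) :
  (0 < Im sigma)%R ->
  unordered_sum (theta_term sigma xi)
    (qpoch_inf (ee sigma) (ee sigma) * theta sigma xi).
Proof.
intros Hs; pose proof (Cmod_ee_lt_1 _ Hs) as Hp.
pose proof (qpoch_inf_neq_0 _ _ Hp Hp) as Hn.
set (E := qpoch_inf (ee sigma) (ee sigma)) in *.
assert (H : unordered_sum (fun n => / E * theta_term sigma xi n) (theta sigma xi)).
2:{ apply (unordered_sum_scal E) in H; revert H; apply unordered_sum_ext.
    intros n; field; exact Hn. }
destruct (theta_term_summable sigma xi Hs) as [B HB].
destruct (inv_qfact_bounded sigma Hs) as [M HM].
destruct (qpoch_bounded (ee sigma) (ee sigma) Hp) as [M' HM'].
assert (M0 : (0 <= M)%R) by (apply Rle_trans with (2 := HM 0%Z), Cmod_ge_0).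
assert (M0' : (0 <= M')%R) by (apply Rle_trans with (2 := HM' O), Cmod_ge_0).
apply tannery with (f := fun N n => finite_theta_coeff sigma N n * theta_term sigma xi n)
  (s := fun N => qpoch (ee xi) (ee sigma) N * qpoch (ee (sigma - xi)) (ee sigma) N)
  (b := fun n => (M' * M * M * Cmod (theta_term sigma xi n))%R) (B := (M' * M * M * B)%R).
- intros L HL; rewrite sumR_scal; apply Rmult_le_compat_l; [|now apply HB].
  now repeat apply Rmult_le_pos.
- intros N n; unfold finite_theta_coeff; rewrite !Cmod_mult.
  apply Rmult_le_compat_r; [apply Cmod_ge_0|].
  apply Rmult_le_compat; [apply Rmult_le_pos; apply Cmod_ge_0|apply Cmod_ge_0| |apply HM].
  apply Rmult_le_compat; [apply Cmod_ge_0|apply Cmod_ge_0|apply HM'|apply HM].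
- intros N; now apply finite_triple_product.
- intros n; apply (tends_mult eventually); [|apply (tends_const eventually)].
  replace (/ E) with (E * / E * / E) by (field; exact Hn).
  unfold finite_theta_coeff; apply (tends_mult eventually); [apply (tends_mult eventually)|].
  + apply tends_comp with (G := eventually) (f := qpoch (ee sigma) (ee sigma));
      [|now apply qpoch_tends].
    apply filterlim_nat_ge; lia.
  + apply inv_qfact_tends; [easy| |exists (Z.abs_nat n); lia].
    intros Q [N HN]; exists (N + Z.abs_nat n)%nat; intros m Hm; apply HN; lia.
  + apply inv_qfact_tends; [easy| |exists (Z.abs_nat n); lia].
    intros Q [N HN]; exists (N + Z.abs_nat n)%nat; intros m Hm; apply HN; lia.
- now apply (tends_mult eventually); apply qpoch_tends.
Qed.

(** * Theta function identities *)

(** Multiply the two bilateral series and sort the terms [(m, n)] by the parity of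
    [m + n]. In terms of [(m + n) / 2] and [(m - n) / 2], or of their analogues
    when [m + n] is odd, the exponent is a sum of two quadratic polynomials in
    one variable, hence each part is a product of two series in base [p^2]. *)
Lemma theta_mul (sigma a b : C) :
  (0 < Im sigma)%R ->
  let J s x := qpoch_inf (ee s) (ee s) * theta s x in
  J sigma a * J sigma b =
  J (2 * sigma) (a + b + 1) * J (2 * sigma) (a - b + sigma - 1)
  - ee a * (J (2 * sigma) (a + b + 1 + sigma) * J (2 * sigma) (a - b + 2 * sigma - 1)).
Proof.
intros Hs J.
assert (Hs2 : (0 < Im (2 * sigma))%R).
{ rewrite Im_scal; lra. }
assert (prod : forall s x y, (0 < Im s)%R ->
  unordered_sum (fun p => theta_term s x (fst p) * theta_term s y (snd p)) (J s x * J s y)).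
{ intros s x y H; apply unordered_sum_prod;
    now try apply theta_term_summable; try apply jacobi_triple_product. }
pose (phi := fun x : Z * Z + Z * Z => match x with
  | inl p => (fst p + snd p, fst p - snd p)%Z
  | inr p => (fst p + snd p + 1, fst p - snd p)%Z end).
pose (psi := fun p : Z * Z =>
  let h := ((fst p + snd p) / 2)%Z in
  if Z.even (fst p + snd p) then inl (h, fst p - h)%Z
  else inr (h, fst p - 1 - h)%Z : (Z * Z + Z * Z)%type).
assert (K1 : forall x, psi (phi x) = x).
{ intros [[s l]|[s l]]; unfold psi, phi; cbn [fst snd].
  - replace (s + l + (s - l))%Z with (s * 2)%Z by ring.
    rewrite Z.even_mul, Z.div_mul by lia.
    replace (Z.even s || Z.even 2)%bool with true by (destruct (Z.even s); easy).
    do 2 f_equal; ring.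
  - replace (s + l + 1 + (s - l))%Z with (1 + s * 2)%Z by ring.
    rewrite Z.even_add, Z.even_mul, Z.div_add by lia.
    replace (Z.even s || Z.even 2)%bool with true by (destruct (Z.even s); easy).
    simpl; do 2 f_equal; ring. }
assert (K2 : forall p, phi (psi p) = p).
{ intros [m n]; unfold psi, phi; cbn [fst snd].
  pose proof (Z.div_mod (m + n) 2 ltac:(lia)) as D.
  rewrite Zmod_even in D.
  destruct (Z.even (m + n)); cbn [fst snd]; f_equal; lia. }
apply (unordered_sum_unique (fun x =>
  theta_term sigma a (fst (phi x)) * theta_term sigma b (snd (phi x)))).
- apply (unordered_sum_bij phi psi (fun p =>
    theta_term sigma a (fst p) * theta_term sigma b (snd p)));
    [easy|easy|now apply prod].
- pose proof (unordered_sum_sum _ _ _ _ (prod (2 * sigma) (a + b + 1) (a - b + sigma - 1) Hs2)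
    (unordered_sum_scal (- ee a) _ _
      (prod (2 * sigma) (a + b + 1 + sigma) (a - b + 2 * sigma - 1) Hs2))) as H.
  match type of H with unordered_sum _ ?t => match goal with |- unordered_sum _ ?u =>
    replace u with t by ring end end.
  revert H; apply unordered_sum_ext; intros [[s l]|[s l]]; unfold phi, theta_term; cbn [fst snd];
    rewrite ?zC_plus, zC_minus.
  + rewrite <- !ee_plus; f_equal; field.
  + replace (- ee a) with (ee (1 + a)) by (rewrite ee_plus, ee_1; ring).
    rewrite <- !ee_plus; f_equal; unfold zC; field.
Qed.

Lemma theta_reflect (sigma xi : C) : theta sigma (sigma - xi) = theta sigma xi.
Proof.
unfold theta; replace (sigma - (sigma - xi)) with xi by ring; ring.
Qed.

Lemma theta_shift (sigma xi : C) :
  (0 < Im sigma)%R -> theta sigma (xi + sigma) = - ee (- xi) * theta sigma xi.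
Proof.
intros Hs; pose proof (Cmod_ee_lt_1 _ Hs) as Hp; unfold theta.
replace (sigma - (xi + sigma)) with (- xi) by ring.
rewrite (qpoch_inf_add (ee xi) _ 1 Hp), (qpoch_inf_add (ee (- xi)) _ 1 Hp).
rewrite !Cpow_1_r, <- !ee_plus; cbn [qpoch Cpow].
replace (- xi + sigma) with (sigma - xi) by ring.
pose proof (ee_opp xi) as H.
set (F := qpoch_inf (ee (xi + sigma)) (ee sigma)).
set (G := qpoch_inf (ee (sigma - xi)) (ee sigma)).
transitivity ((1 - ee (- xi)) * F * G); [ring|].
transitivity ((ee xi * ee (- xi) - ee (- xi)) * F * G); [now rewrite H|ring].
Qed.

Lemma theta_0 (sigma : C) : (0 < Im sigma)%R -> theta sigma 0 = 0.
Proof.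
intros Hs; unfold theta.
rewrite (qpoch_inf_add (ee 0) _ 1 (Cmod_ee_lt_1 _ Hs)); cbn [qpoch Cpow].
rewrite ee_0; ring.
Qed.

(** In [theta_mul] the variable [w] enters only the factors that depend on the sum
    of the arguments, and [c] only those that depend on their difference. *)
Lemma theta_pairs_rank_2 (sigma gamma : C) :
  (0 < Im sigma)%R ->
  exists S0 S1 T0 T1 : C -> C, forall w c,
  theta sigma (w + c) * theta sigma (w + gamma - c) = S0 w * T0 c + S1 w * T1 c.
Proof.
intros Hs; pose proof (Cmod_ee_lt_1 _ Hs) as Hp.
pose proof (qpoch_inf_neq_0 _ _ Hp Hp) as Hn.
set (E := qpoch_inf (ee sigma) (ee sigma)) in *.
pose (J s x := qpoch_inf (ee s) (ee s) * theta s x).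
exists (fun w => J (2 * sigma) (2 * w + gamma + 1)).
exists (fun w => - ee w * J (2 * sigma) (2 * w + gamma + 1 + sigma)).
exists (fun c => J (2 * sigma) (2 * c - gamma + sigma - 1) / (E * E)).
exists (fun c => ee c * J (2 * sigma) (2 * c - gamma + 2 * sigma - 1) / (E * E)).
intros w c.
pose proof (theta_mul sigma (w + c) (w + gamma - c) Hs) as H; cbv beta zeta in H; fold E in H.
replace (w + c + (w + gamma - c)) with (2 * w + gamma) in H by ring.
replace (w + c - (w + gamma - c)) with (2 * c - gamma) in H by ring.
rewrite ee_plus in H.
transitivity ((E * theta sigma (w + c) * (E * theta sigma (w + gamma - c))) / (E * E)).
- field; exact Hn.
- rewrite H; unfold J; field; exact Hn.
Qed.

(** A kernel of rank two has vanishing three by three minors. *)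
Lemma theta_pairs_det (sigma gamma w1 w2 w3 c1 c2 c3 : C) :
  (0 < Im sigma)%R ->
  let g w c := theta sigma (w + c) * theta sigma (w + gamma - c) in
  g w1 c1 * (g w2 c2 * g w3 c3 - g w2 c3 * g w3 c2)
  - g w1 c2 * (g w2 c1 * g w3 c3 - g w2 c3 * g w3 c1)
  + g w1 c3 * (g w2 c1 * g w3 c2 - g w2 c2 * g w3 c1) = 0.
Proof.
intros Hs g; destruct (theta_pairs_rank_2 sigma gamma Hs) as [S0 [S1 [T0 [T1 H]]]].
unfold g; rewrite !H; ring.
Qed.

(** The minor of [theta_pairs_det] for the shifts [2 tau], [3 tau], [0] and the
    points [w], [0], [- 3 tau]. The last two points are zeros of the third and of
    the second pair, so that the first pair is expressed through the other two,
    with the coefficients read off at these points. *)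
Lemma theta_cubic (tau w : C) :
  (0 < Im tau)%R ->
  let th := theta (6 * tau) in
  th (3 * tau) ^ 2 * (th (w + 2 * tau) * th (w + 4 * tau)) =
  th (2 * tau) ^ 2 * th (w + 3 * tau) ^ 2
  - ee (2 * tau - w) * th tau ^ 2 * th w ^ 2.
Proof.
intros Ht th.
assert (Hs : (0 < Im (6 * tau))%R).
{ rewrite Im_scal; lra. }
pose proof (theta_pairs_det (6 * tau) (6 * tau) w 0 (- (3 * tau)) (2 * tau) (3 * tau) 0 Hs) as D.
cbv beta zeta in D; fold th in D.
assert (th0 : th 0 = 0) by now apply theta_0.
assert (shift : forall x, th (x + 6 * tau) = - ee (- x) * th x) by (intros; now apply theta_shift).
assert (refl : forall x, th (6 * tau - x) = th x) by (intros; apply theta_reflect).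
assert (th4 : th (4 * tau) = th (2 * tau)) by (rewrite <- refl; f_equal; ring).
assert (neg : forall x, th (- x) = - ee (- x) * th x).
{ intros x; pose proof (shift (- x)) as H.
  replace (- x + 6 * tau) with (6 * tau - x) in H by ring; rewrite refl in H; rewrite H.
  replace (- - x) with x by ring.
  replace (- ee (- x) * (- ee x * th (- x))) with (ee x * ee (- x) * th (- x)) by ring.
  rewrite ee_opp; ring. }
replace (w + 6 * tau - 2 * tau) with (w + 4 * tau) in D by ring.
replace (w + 6 * tau - 3 * tau) with (w + 3 * tau) in D by ring.
replace (w + 6 * tau - 0) with (w + 6 * tau) in D by ring.
replace (w + 0) with w in D by ring.
replace (0 + 6 * tau - 2 * tau) with (4 * tau) in D by ring.
replace (0 + 6 * tau - 3 * tau) with (3 * tau) in D by ring.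
replace (0 + 2 * tau) with (2 * tau) in D by ring.
replace (0 + 3 * tau) with (3 * tau) in D by ring.
replace (0 + 0) with (RtoC 0) in D by ring.
replace (- (3 * tau) + 2 * tau) with (- tau) in D by ring.
replace (- (3 * tau) + 6 * tau - 2 * tau) with tau in D by ring.
replace (- (3 * tau) + 3 * tau) with (RtoC 0) in D by ring.
replace (- (3 * tau) + 6 * tau - 0) with (3 * tau) in D by ring.
replace (- (3 * tau) + 0) with (- (3 * tau)) in D by ring.
rewrite shift, (neg tau), (neg (3 * tau)), th0, th4 in D.
assert (n3 : th (3 * tau) <> 0).
{ assert (h3 : (Cmod (ee (3 * tau)) < 1)%R) by (apply Cmod_ee_lt_1; rewrite Im_scal; lra).
  pose proof (Cmod_ee_lt_1 _ Hs) as h6.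
  unfold th, theta; replace (6 * tau - 3 * tau) with (3 * tau) by ring.
  apply Cmult_neq_0; exact (qpoch_inf_neq_0 _ _ h3 h6). }
assert (E1 : ee (- tau) = ee (- (3 * tau)) * ee (2 * tau)) by (rewrite <- ee_plus; f_equal; ring).
replace (2 * tau - w) with (2 * tau + - w) by ring; rewrite ee_plus.
rewrite E1 in D.
pose proof (ee_neq_0 (- (3 * tau))) as n1.
set (u := ee (- (3 * tau))) in *.
set (T1 := th tau) in *; set (T2 := th (2 * tau)) in *; set (T3 := th (3 * tau)) in *.
set (W := th w) in *; set (W2 := th (w + 2 * tau)) in *; set (W3 := th (w + 3 * tau)) in *.
set (W4 := th (w + 4 * tau)) in *.
match goal with |- ?a = ?b =>
  assert (Z : u * T3 ^ 2 * (b - a) = 0);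
  [|destruct (Ceq_dec a b) as [e|n]; [exact e|]] end.
- rewrite <- D; ring.
- exfalso; revert Z; apply Cmult_neq_0.
  + apply Cmult_neq_0; [exact n1|exact (Cpow_nz _ 2 n3)].
  + intros Z; apply n; match type of Z with ?b - ?a = _ =>
      transitivity (b - (b - a)); [ring|rewrite Z; ring] end.
Qed.

Lemma theta_split3 (tau xi : C) :
  (0 < Im tau)%R ->
  theta (2 * tau) xi =
  theta (6 * tau) xi * (theta (6 * tau) (xi + 2 * tau) * theta (6 * tau) (xi + 4 * tau)).
Proof.
intros Ht.
assert (Hp : (Cmod (ee (2 * tau)) < 1)%R).
{ apply Cmod_ee_lt_1; rewrite Im_scal; lra. }
assert (P3 : ee (2 * tau) ^ 3 = ee (6 * tau))
  by (cbn [Cpow]; rewrite Cmult_1_r, <- !ee_plus; f_equal; ring).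
unfold theta.
rewrite (qpoch_inf_split3 (ee xi) _ Hp), (qpoch_inf_split3 (ee (2 * tau - xi)) _ Hp), P3.
cbn [Cpow]; rewrite Cmult_1_r, <- !ee_plus.
replace (2 * tau + 2 * tau) with (4 * tau) by ring.
replace (6 * tau - (xi + 2 * tau)) with (2 * tau - xi + 2 * tau) by ring.
replace (6 * tau - (xi + 4 * tau)) with (2 * tau - xi) by ring.
replace (6 * tau - xi) with (2 * tau - xi + 4 * tau) by ring.
ring.
Qed.

(** * Gosper's functions *)

Lemma sin_q_theta (tau w : C) :
  sin_q tau w =
  ee (tau * (w / PI - 1 / 2) ^ 2) * theta (2 * tau) (2 * tau * (w / PI))
  / qpoch_inf (ee tau) (ee (2 * tau)) ^ 2.
Proof.
unfold sin_q, theta; cbv zeta; rewrite !qpow_ee.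
set (x := w / PI); rewrite (Cmult_comm tau 2), Cmult_1_r.
replace (tau * (2 * x)) with (2 * tau * x) by ring.
replace (tau * (2 - 2 * x)) with (2 * tau - 2 * tau * x) by ring.
reflexivity.
Qed.

Lemma cos_q_theta (tau w : C) :
  cos_q tau w =
  ee (tau * (w / PI) ^ 2) * theta (2 * tau) (2 * tau * (w / PI) + tau)
  / qpoch_inf (ee tau) (ee (2 * tau)) ^ 2.
Proof.
unfold cos_q, theta; cbv zeta; rewrite !qpow_ee.
set (x := w / PI); rewrite (Cmult_comm tau 2), Cmult_1_r.
replace (tau * (1 + 2 * x)) with (2 * tau * x + tau) by ring.
replace (tau * (1 - 2 * x)) with (2 * tau - (2 * tau * x + tau)) by ring.
reflexivity.
Qed.

Lemma Pi_q_ee (tau : C) :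
  Pi_q tau =
  ee (tau * (1 / 4)) * qpoch_inf (ee (2 * tau)) (ee (2 * tau)) ^ 2
  / qpoch_inf (ee tau) (ee (2 * tau)) ^ 2.
Proof.
unfold Pi_q; rewrite !qpow_ee, Cmult_1_r, (Cmult_comm tau 2); reflexivity.
Qed.

Lemma theta_half_period (tau : C) :
  theta (2 * tau) tau = qpoch_inf (ee tau) (ee (2 * tau)) ^ 2.
Proof.
unfold theta; replace (2 * tau - tau) with tau by ring; ring.
Qed.

Lemma qpoch_inf_odd_split3 (tau : C) :
  (0 < Im tau)%R ->
  qpoch_inf (ee tau) (ee (2 * tau)) =
  theta (6 * tau) tau * qpoch_inf (ee (3 * tau)) (ee (6 * tau)).
Proof.
intros Ht; unfold theta.
rewrite qpoch_inf_split3.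
2:{ apply Cmod_ee_lt_1; rewrite Im_scal; lra. }
replace (ee (2 * tau) ^ 3) with (ee (6 * tau))
  by (cbn [Cpow]; rewrite Cmult_1_r, <- !ee_plus; f_equal; ring).
cbn [Cpow]; rewrite Cmult_1_r, <- !ee_plus.
replace (tau + 2 * tau) with (3 * tau) by ring.
replace (tau + (2 * tau + 2 * tau)) with (6 * tau - tau) by ring.
ring.
Qed.

Lemma qpoch_inf_even_split3 (tau : C) :
  (0 < Im tau)%R ->
  qpoch_inf (ee (2 * tau)) (ee (2 * tau)) =
  theta (6 * tau) (2 * tau) * qpoch_inf (ee (6 * tau)) (ee (6 * tau)).
Proof.
intros Ht; unfold theta.
rewrite qpoch_inf_split3.
2:{ apply Cmod_ee_lt_1; rewrite Im_scal; lra. }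
replace (ee (2 * tau) ^ 3) with (ee (6 * tau))
  by (cbn [Cpow]; rewrite Cmult_1_r, <- !ee_plus; f_equal; ring).
cbn [Cpow]; rewrite Cmult_1_r, <- !ee_plus.
replace (2 * tau + 2 * tau) with (6 * tau - 2 * tau) by ring.
replace (2 * tau + (6 * tau - 2 * tau)) with (6 * tau) by ring.
ring.
Qed.

(** With [w = 6 tau x], where [x = z / PI], all three terms share the factor
    [theta (6 tau) w], and what remains is [theta_cubic]. *)
Theorem corollary3 (tau : C) (htau : (0 < Im tau)%R) (z : C) :
  sin_q tau (3 * z) =
  Pi_q tau / Pi_q (3 * tau) * cos_q (3 * tau) z ^ 2 * sin_q (3 * tau) z
  - sin_q (3 * tau) z ^ 3.
Proof.
rewrite !sin_q_theta, cos_q_theta, !Pi_q_ee.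
set (x := z / PI); replace (3 * z / PI) with (3 * x) by (unfold x, Cdiv; ring).
pose proof (theta_cubic tau (6 * tau * x) htau) as cubic; cbv beta zeta in cubic.
pose proof (theta_half_period (3 * tau)) as half.
replace (2 * (3 * tau)) with (6 * tau) in * by ring.
replace (2 * tau * (3 * x)) with (6 * tau * x) by ring.
rewrite (theta_split3 tau (6 * tau * x) htau).
rewrite (qpoch_inf_odd_split3 tau htau), (qpoch_inf_even_split3 tau htau).
rewrite half in cubic.
assert (H6 : (Cmod (ee (6 * tau)) < 1)%R) by (apply Cmod_ee_lt_1; rewrite Im_scal; lra).
assert (nE : qpoch_inf (ee (6 * tau)) (ee (6 * tau)) <> 0) by now apply qpoch_inf_neq_0.
assert (nK : qpoch_inf (ee (3 * tau)) (ee (6 * tau)) <> 0).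
{ apply qpoch_inf_neq_0; [|easy]; apply Cmod_ee_lt_1; rewrite Im_scal; lra. }
assert (n1 : theta (6 * tau) tau <> 0).
{ unfold theta; apply Cmult_neq_0; (apply qpoch_inf_neq_0; [|easy]); apply Cmod_ee_lt_1.
  - easy.
  - replace (6 * tau - tau) with (5 * tau) by ring; rewrite Im_scal; lra. }
(* The prefactors of the three terms agree once their exponents, quadratic in
   [x], are compared. *)
assert (x1 : ee (tau * (3 * x - 1 / 2) ^ 2) * ee (3 * tau * (1 / 4)) =
  ee (3 * tau * x ^ 2) ^ 2 * ee (3 * tau * (x - 1 / 2) ^ 2) * ee (tau * (1 / 4))).
{ cbn [Cpow]; rewrite !Cmult_1_r, <- !ee_plus; f_equal; field. }
assert (x2 : ee (3 * tau * (x - 1 / 2) ^ 2) ^ 3 =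
  ee (tau * (3 * x - 1 / 2) ^ 2) * ee (2 * tau - 6 * tau * x)).
{ cbn [Cpow]; rewrite !Cmult_1_r, <- !ee_plus; f_equal; field. }
pose proof (ee_neq_0 (3 * tau * (1 / 4))) as n3.
set (E := qpoch_inf (ee (6 * tau)) (ee (6 * tau))) in *.
set (K := qpoch_inf (ee (3 * tau)) (ee (6 * tau))) in *.
set (T1 := theta (6 * tau) tau) in *; set (T2 := theta (6 * tau) (2 * tau)) in *.
set (W := theta (6 * tau) (6 * tau * x)) in *.
set (W3 := theta (6 * tau) (6 * tau * x + 3 * tau)) in *.
set (W24 := theta (6 * tau) (6 * tau * x + 2 * tau) * theta (6 * tau) (6 * tau * x + 4 * tau)) in *.
set (B := ee (3 * tau * (x - 1 / 2) ^ 2)) in *; set (A := ee (3 * tau * x ^ 2)) in *.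
set (q1 := ee (tau * (1 / 4))) in *; set (q3 := ee (3 * tau * (1 / 4))) in *.
set (L := ee (tau * (3 * x - 1 / 2) ^ 2)) in *; set (c := ee (2 * tau - 6 * tau * x)) in *.
assert (cubic' : W24 = (T2 ^ 2 * W3 ^ 2 - c * T1 ^ 2 * W ^ 2) / K ^ 4)
  by (rewrite <- cubic; field; exact nK).
transitivity ((A ^ 2 * B * q1) / q3 * T2 ^ 2 * W3 ^ 2 * W / (T1 ^ 2 * K ^ 6)
  - B ^ 3 * W ^ 3 / K ^ 6).
- rewrite <- x1, x2, cubic'; field; repeat split; assumption.
- field; repeat split; assumption.
Qed.
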